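(* Let $X \subset \mathbb{R}^2$ be a set of $N$ points in general position, and let $H \ge 1$ and $K \ge 1$ be integers with $K \ge \lceil \frac{N}{2H} \rceil$. Then $\mathrm{CUT}_K(X) \le H$.
   Context: General position means no three points of $X$ are collinear. A simple arrangement of $K$ lines is a set of $K$ lines in the plane, no two parallel and no three passing through a common point; its cells are the connected components of the complement in $\mathbb{R}^2$ of the union of the lines (there are $\frac{K^2+K+2}{2}$ of them). The cutting number is $\mathrm{CUT}_K(X) = \min_{\mathcal{A}_K} \max_{\text{cells } c \text{ of } \mathcal{A}_K} |X \cap c|$, where the minimum is over simple arrangements $\mathcal{A}_K$ of $K$ lines (as implicit in the paper, the lines are taken to avoid the points of $X$, so every point of $X$ lies in some cell). *)

(* Defs.v *)
From HB Require Import structures.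
From mathcomp Require Import all_boot all_order all_algebra finmap.
From mathcomp Require Import ring lra.
From mathcomp Require Import all_classical all_reals all_analysis.
Set Implicit Arguments.
Unset Strict Implicit.
Unset Printing Implicit Defensive.
Import Order.TTheory GRing.Theory Num.Theory numFieldNormedType.Exports.
Local Open Scope classical_set_scope.
Local Open Scope ring_scope.

Definition is_line (R : realType) (l : set (R * R)) : Prop :=
  exists a b c : R, (a, b) != (0, 0) /\ l = [set p | a * p.1 + b * p.2 = c].

Definition collinear (R : realType) (p q r : R * R) : Prop :=
  exists l, is_line l /\ l p /\ l q /\ l r.

Definition general_position (R : realType) (X : {fset R * R}) : Prop :=
  forall p q r, p \in X -> q \in X -> r \in X ->
    p != q -> p != r -> q != r -> ~ collinear p q r.

(* Meant for distinct lines: no line is parallel to itself in this sense. *)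
Definition parallel (R : realType) (l m : set (R * R)) : Prop := l `&` m = set0.

Definition simple_arrangement (R : realType) (K : nat)
    (A : {fset set (R * R)}) : Prop :=
  [/\ #|` A| = K,
      forall l, l \in A -> is_line l,
      forall l m, l \in A -> m \in A -> l != m -> ~ parallel l m
    & forall l m n, l \in A -> m \in A -> n \in A ->
        l != m -> l != n -> m != n -> l `&` m `&` n = set0].

Definition lines_union (R : realType) (A : {fset set (R * R)}) : set (R * R) :=
  \bigcup_(l in [set` A]) l.

Definition cells (R : realType) (A : {fset set (R * R)}) : set (set (R * R)) :=
  [set connected_component (~` lines_union A) x | x in ~` lines_union A].

Definition avoids (R : realType) (A : {fset set (R * R)}) (X : {fset R * R}) :
    Prop :=
  forall x, x \in X -> ~ lines_union A x.

Definition cell_count (R : realType) (X : {fset R * R}) (c : set (R * R)) : nat :=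
  #|` fset_set ([set` X] `&` c)|.

(* The bound on n loses nothing, as [cell_count X] is at most [#|` X|]; the
   default value 0 is not used, as finitely many lines do not cover the plane. *)
Definition max_cell_count (R : realType) (X : {fset R * R})
    (A : {fset set (R * R)}) : nat :=
  (\max_(n < #|` X|.+1 | `[< exists2 c, cells A c & cell_count X c = n >]) n)%N.

Definition max_cell_value (R : realType) (K : nat) (X : {fset R * R}) : pred nat :=
  fun m => `[< exists A : {fset set (R * R)},
    [/\ simple_arrangement K A, avoids A X & max_cell_count X A = m] >].

(* Tangent to the parabola y = x^2 at (n, n^2). *)
Definition tangent (R : realType) (n : nat) : set (R * R) :=
  [set p | 2 * n%:R * p.1 + (-1) * p.2 = n%:R ^+ 2].

Lemma tangent_inj (R : realType) : injective (@tangent R).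
Proof.
move=> n m e.
have : tangent n (n%:R : R, n%:R ^+ 2 : R) by rewrite /tangent /=; ring.
rewrite e /tangent /= => h.
have /eqP : (n%:R - m%:R : R) ^+ 2 = 0 by lra.
by rewrite sqrf_eq0 subr_eq0 eqr_nat => /eqP.
Qed.

Lemma tangent_meet (R : realType) (n m : nat) (p : R * R) :
  n != m -> tangent n p -> tangent m p -> n%:R + m%:R = 2 * p.1.
Proof.
rewrite -(eqr_nat R) -subr_eq0 /tangent /= => nm h1 h2.
by apply: (mulfI nm); lra.
Qed.

Lemma tangent_far (R : realType) (X : seq (R * R)) :
  exists M, forall n x, (M <= n)%N -> x \in X -> ~ tangent n x.
Proof.
elim: X => [|x X [M IH]]; first by exists 0%N => n x _; rewrite in_nil.
exists (maxn M (Num.bound (2 * `|x.1| + `|x.2| + 1))) => n y.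
rewrite geq_max => /andP[Mn bn]; rewrite in_cons => /orP[/eqP ->|yX]; last exact: IH.
have hn : 2 * `|x.1| + `|x.2| + 1 < n%:R.
  apply: (@lt_le_trans _ _ (Num.bound (2 * `|x.1| + `|x.2| + 1))%:R); last by rewrite ler_nat.
  by apply: archi_boundP; have := normr_ge0 x.1; have := normr_ge0 x.2; lra.
have h1 := ler_norm x.1; have h2 := ler_norm (- x.2).
rewrite normrN in h2.
have h3 := normr_ge0 x.1; have h4 := normr_ge0 x.2.
rewrite /tangent /= => e.
have : 0 <= (n%:R - 1) * (n%:R - 2 * x.1 - 1) by apply: mulr_ge0; lra.
lra.
Qed.

Lemma max_cell_value_ex (R : realType) (K : nat) (X : {fset R * R}) :
  exists m, max_cell_value K X m.
Proof.
have [M hM] := tangent_far X.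
pose A : {fset set (R * R)} := [fset @tangent R n | n in iota M K]%fset.
have AP l : l \in A -> exists2 n, (M <= n)%N & l = @tangent R n.
  by move=> /imfsetP[n /=]; rewrite mem_iota => /andP[? _] ->; exists n.
exists (max_cell_count X A); apply/asboolP; exists A; split => //; last first.
  by move=> x xX [l /= /AP[n Mn ->]]; exact: hM.
split.
- rewrite /A card_imfset; last exact: tangent_inj.
  by rewrite /= undup_id ?iota_uniq// size_iota.
- move=> l /AP[n _ ->]; exists (2 * n%:R), (-1), (n%:R ^+ 2); split=> //.
  by apply/eqP => -[_ /eqP]; rewrite oppr_eq0 oner_eq0.
- move=> _ _ /AP[n _ ->] /AP[m _ ->] _; rewrite /parallel => e.
  suff : (set0 : set (R * R)) ((n%:R + m%:R) / 2, n%:R * m%:R) by [].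
  by rewrite -e /tangent; split => /=; field.
- move=> _ _ _ /AP[n _ ->] /AP[m _ ->] /AP[k _ ->] nm nk mk.
  have ne i j : @tangent R i != tangent j -> i != j.
    by apply: contra_neq => ->.
  apply/seteqP; split => // p [[pn pm] pk].
  have e1 := tangent_meet (ne _ _ nm) pn pm.
  have e2 := tangent_meet (ne _ _ nk) pn pk.
  have /eqP : m%:R = k%:R :> R by lra.
  by rewrite eqr_nat (negbTE (ne _ _ mk)).
Qed.

Definition CUT (R : realType) (K : nat) (X : {fset R * R}) : nat :=
  ex_minn (max_cell_value_ex K X).

(* Main.v *)
(* A line cuts [X] into two halves [A], [B] of sizes differing by at most one, so
   each has at most [H * K] points. As [A] and [B] are separated by a line, some
   line cuts off exactly [H] points from each of them, on the same side; repeat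
   this with the remaining points [K - 1] times. On either side of the first line,
   two points not separated by any of the other lines were cut off in the same
   round, or both remain at the end: hence a cell has at most [H] points.
   Finally the lines are moved one by one into simple position without changing
   their sides with respect to the points of [X]. *)
Require Import Defs.
From mathcomp Require Import all_boot all_order all_algebra finmap.
From mathcomp Require Import zify ring lra.
From mathcomp Require Import all_classical all_reals all_analysis.
Set Implicit Arguments.
Unset Strict Implicit.
Unset Printing Implicit Defensive.
Import Order.TTheory GRing.Theory Num.Theory numFieldNormedType.Exports.
Local Open Scope classical_set_scope.
Local Open Scope ring_scope.

(** * Extremal choices and comparisons in ordered fields *)

Lemma seq_argmax (R : realDomainType) (T : eqType) (f : T -> R) (s : seq T) :
  s != [::] -> exists2 x, x \in s & forall y, y \in s -> f y <= f x.
Proof.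
elim: s => // a s IH _; have [->|s0] := eqVneq s [::].
  by exists a => [|y]; rewrite mem_seq1// => /eqP ->.
have [x xs xmax] := IH s0; have [ax|xa] := leP (f a) (f x).
  exists x => [|y]; first by rewrite inE xs orbT.
  by rewrite inE => /orP[/eqP->//|]; exact: xmax.
exists a => [|y]; first by rewrite inE eqxx.
rewrite inE => /orP[/eqP->//|/xmax yx]; exact: le_trans yx (ltW xa).
Qed.

(** Leaves room to raise a bound without passing another value or, for [v = 0], to choose a small
    enough positive number. *)
Lemma right_gap (R : realFieldType) (s : seq R) (v : R) :
  exists2 d, v < d & forall x, x \in s -> v < x -> d < x.
Proof.
elim: s => [|a s [d vd IH]]; first by exists (v + 1) => //; lra.
have [va|av] := ltP v a.
  exists (Num.min d ((v + a) / 2)); first by rewrite lt_min vd; lra.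
  move=> x; rewrite inE gt_min => /orP[/eqP->|xs] vx; first by apply/orP; right; lra.
  by rewrite IH.
exists d => // x; rewrite inE => /orP[/eqP->|]; last exact: IH.
by rewrite ltNge av.
Qed.

(** The product of the polynomials has fewer roots than its size, while [e / 2, e / 3, ...] are
    distinct points below [e]. *)
Lemma avoid_roots (R : realFieldType) (ps : seq {poly R}) (e : R) :
  0 < e -> all (fun p => p != 0) ps ->
  exists s, [/\ 0 < s, s < e & all (fun p => p.[s] != 0) ps].
Proof.
move=> e0 ps0; pose P := \prod_(p <- ps) p.
have P0 : P != 0 by rewrite /P prodf_seq_neq0.
pose g (i : nat) : R := e / i.+2%:R.
have g_inj : injective g.
  move=> i j /(mulfI (lt0r_neq0 e0)) /invr_inj /eqP.
  by rewrite eqr_nat => /eqP [].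
have /allPn[x /mapP[i _ ->] Px] : ~~ all (root P) [seq g i | i <- iota 0 (size P)].
  apply/negP => aP; have := max_poly_roots P0 aP.
  by rewrite map_inj_uniq// iota_uniq size_map size_iota ltnn => /(_ isT).
exists (g i); split.
- by rewrite divr_gt0.
- by rewrite ltr_pdivrMr// ltr_pMr// ltr1n.
- apply/allP => p pps; apply: contra Px => /eqP px.
  by rewrite /P /root (big_rem p) //= hornerM px mul0r.
Qed.

(** Induction on [n]: the threshold moves just past the least value above it, which by injectivity
    is attained only once. *)
Lemma count_lt_exists (R : realFieldType) (T : eqType) (f : T -> R) (s : seq T)
    (n : nat) :
  uniq s -> {in s &, injective f} -> (n <= size s)%N ->
  exists2 d, all (fun x => f x != d) s & count (fun x => f x < d) s = n.
Proof.
move=> us fi; elim: n => [_|n IH ns].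
  have [->|s0] := eqVneq s [::]; first by exists 0.
  have [x _ xmin] := seq_argmax (fun x => - f x) s0.
  have lts y : y \in s -> f x - 1 < f y by move=> /xmin; lra.
  exists (f x - 1); first by apply/allP => y /lts; rewrite lt_neqAle eq_sym => /andP[].
  by apply/eqP; rewrite -leqn0 leqNgt -has_count; apply/hasPn => y /lts /=; rewrite -leNgt => /ltW.
have [d ad cd] := IH (ltnW ns).
have [|p] := @seq_argmax _ _ (fun x => - f x) [seq x <- s | d < f x].
  rewrite -size_eq0 size_filter.
  have := count_predC (fun x => f x < d) s.
  have -> : count (predC (fun x => f x < d)) s = count (fun x => d < f x) s.
    apply: eq_in_count => x xs /=; rewrite -leNgt le_eqVlt eq_sym.
    by rewrite (negbTE (allP ad x xs)).
  by rewrite cd; lia.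
rewrite mem_filter => /andP[dp ps] pmin.
have [e pe he] := right_gap [seq f x | x <- s] (f p).
have lep x : x \in s -> (f x < e) = (f x <= f p).
  move=> xs; apply/idP/idP => [xe|]; last by move/le_lt_trans; apply.
  rewrite leNgt; apply/negP => px.
  by have := he _ (map_f f xs) px; rewrite ltNge ltW.
exists e.
  apply/allP => x xs; apply/eqP => fx.
  by have := he _ (map_f f xs); rewrite fx ltxx => /(_ pe).
transitivity (count (predU (fun x => f x < d) (pred1 p)) s).
  apply: eq_in_count => x xs /=; rewrite lep//; apply/idP/orP => [xp|].
    have [xd|dx] := ltP (f x) d; [by left | right].
    apply/eqP/fi => //; apply/eqP; rewrite eq_le xp /= -lerN2 pmin//.
    by rewrite mem_filter xs andbT lt_neqAle eq_sym (allP ad x xs).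
  move=> [xd|/eqP->//]; apply/ltW/(lt_trans xd dp).
have := count_predUI (fun x => f x < d) (pred1 p) s.
rewrite cd (count_uniq_mem _ us) ps addn1 => <-.
rewrite -[LHS]addn0; congr addn; apply/esym/eqP; rewrite -leqn0 leqNgt -has_count.
by apply/hasPn => x xs /=; apply/negP => /andP[xd /eqP xp]; move: xd; rewrite xp ltNge ltW.
Qed.

(** The value of an affine function at 0 is a convex combination, with positive weights, of its
    values at [x1] and [x2]. *)
Lemma lt_intercept (R : realFieldType) (x1 x2 y1 y2 m c k d : R) :
  x1 < 0 -> 0 < x2 -> y1 = m * x1 + c -> y2 = m * x2 + c ->
  y1 < k * x1 + d -> y2 <= k * x2 + d -> c < d.
Proof.
move=> x1n x2p -> -> h1 h2; have : 0 < (d - c) * (x2 - x1).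
  have : 0 < x2 * (k * x1 + d - (m * x1 + c)) by apply: mulr_gt0; lra.
  have : 0 <= - x1 * (k * x2 + d - (m * x2 + c)) by apply: mulr_ge0; lra.
  by lra.
by rewrite pmulr_lgt0; lra.
Qed.

(** * Cutting equally many points from two sets separated by an axis *)

Section Cut.
Variables (R : realFieldType) (T : eqType) (u v : T -> R).

Let slope p q := (v q - v p) / (u q - u p).
Let icpt p q := v p - slope p q * u p.

Let interpl p q : v p = slope p q * u p + icpt p q.
Proof. by rewrite /icpt; ring. Qed.

Let interpr p q : u p < 0 -> 0 < u q -> v q = slope p q * u q + icpt p q.
Proof. by move=> up uq; rewrite /icpt /slope; field; lra. Qed.

(** Take the pair whose line meets the axis [u = 0] highest: a point above this line could replace
    the endpoint on its own side and raise the intercept. *)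
Lemma upper_bridge (C D : seq T) : C != [::] -> D != [::] ->
  (forall p, p \in C -> u p < 0) -> (forall q, q \in D -> 0 < u q) ->
  exists p q, [/\ p \in C, q \in D &
    forall x, x \in C ++ D -> v x <= slope p q * u x + icpt p q].
Proof.
move=> nC nD Cn Dp.
have [|pq] := @seq_argmax _ _ (fun w => icpt w.1 w.2) [seq (p, q) | p <- C, q <- D].
  by rewrite -size_eq0 size_allpairs muln_eq0 !size_eq0 negb_or nC.
move=> /allpairsP[[p q] /= [pC qD ->]] pqmax.
exists p, q; split => // x; rewrite mem_cat leNgt => /orP[xC|xD]; apply/negP => lx.
  have := pqmax (x, q) (allpairs_f _ xC qD); rewrite /= leNgt => /negP; apply.
  rewrite -ltrN2; apply: (@lt_intercept _ (u x) (u q) (- v x) (- v q)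
    (- slope x q) _ (- slope p q)); rewrite ?Cn ?Dp//.
  - by rewrite [in LHS](interpl x q); ring.
  - by rewrite [in LHS](@interpr x q) ?Cn ?Dp//; ring.
  - by lra.
  - by rewrite [in leLHS](@interpr p q) ?Cn ?Dp//; lra.
have := pqmax (p, x) (allpairs_f _ pC xD); rewrite /= leNgt => /negP; apply.
have e1 := interpl p q; have e2 := interpl p x.
have e3 : v x = _ := @interpr p x (Cn _ pC) (Dp _ xD).
(* Both coordinates are negated, because [lt_intercept] expects strictness at the point of negative
   abscissa, here [x]. *)
rewrite -ltrN2; apply: (@lt_intercept _ (- u x) (- u p) (- v x) (- v p)
    (slope p x) _ (slope p q)); rewrite ?oppr_lt0 ?oppr_gt0 ?Cn ?Dp//; lra.
Qed.

(* Among the lines through some [p] of [A] and [q] of [B] having at least [n]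
   points of each of [A] and [B] on or below them, take one meeting the axis
   [u = 0] lowest. If more than [n] points of [A] (say) were on or below it, then
   at least [n] would be strictly below it, and the upper bridge of these and of
   the points of [B] on or below it would meet the axis lower. *)
Lemma simultaneous_cut (A B X : seq T) (n : nat) :
  uniq A -> uniq B -> (0 < n)%N -> (n <= size A)%N -> (n <= size B)%N ->
  (forall p, p \in A -> u p < 0) -> (forall q, q \in B -> 0 < u q) ->
  (forall p q r m c, p \in A -> q \in B -> r \in A ++ B ->
     v p = m * u p + c -> v q = m * u q + c -> v r = m * u r + c ->
     (r == p) || (r == q)) ->
  exists m c, [/\ all (fun x => v x != m * u x + c) X,
    count (fun x => v x < m * u x + c) A = n &
    count (fun x => v x < m * u x + c) B = n].
Proof.
move=> uA uB n0 nA nB An Bp nd.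
pose le p q x := v x <= slope p q * u x + icpt p q.
pose lt p q x := v x < slope p q * u x + icpt p q.
pose good w := (n <= count (le w.1 w.2) A)%N && (n <= count (le w.1 w.2) B)%N.
(* All of [C] and [D] lies on or below the bridge, so its endpoints form a good pair. *)
have bridge C D : (n <= size C)%N -> (n <= size D)%N -> uniq C -> uniq D ->
    {subset C <= A} -> {subset D <= B} ->
    exists p q, [/\ p \in C, q \in D & good (p, q)].
  move=> nS nT uS uT SA TB; have [| | |q Tq|p [q [pS qT lepq]]] := @upper_bridge C D.
  - by rewrite -size_eq0; lia.
  - by rewrite -size_eq0; lia.
  - by move=> p /SA/An.
  - by apply/Bp/TB.
  exists p, q; split => //; apply/andP; split => /=; rewrite -size_filter.
    apply: (leq_trans nS); apply: uniq_leq_size => // x xS.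
    by rewrite mem_filter SA// /le lepq// mem_cat xS.
  apply: (leq_trans nT); apply: uniq_leq_size => // x xT.
  by rewrite mem_filter TB// /le lepq// mem_cat xT orbT.
have [|pq] := @seq_argmax _ _ (fun w => - icpt w.1 w.2)
    [seq w <- [seq (p, q) | p <- A, q <- B] | good w].
  have [p [q [pA qB g]]] := bridge A B nA nB uA uB (fun _ h => h) (fun _ h => h).
  apply/eqP => e; have := in_nil (p, q); rewrite -e mem_filter g /=.
  by rewrite allpairs_f.
rewrite mem_filter => /andP[+ /allpairsP[[p q] /= [pA qB epq]]].
rewrite epq => /andP[/= gA gB] /= pqmin.
have ep := interpl p q; have eq := @interpr p q (An _ pA) (Bp _ qB).
have minimal p' q' : p' \in A -> q' \in B -> good (p', q') ->
    le p q p' -> le p q q' -> lt p q p' || lt p q q' -> False.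
  move=> pA' qB' g' lp lq /orP ls.
  have := pqmin (p', q'); rewrite mem_filter g' allpairs_f// => /(_ isT) /=.
  rewrite lerN2 leNgt => /negP; apply.
  have e1 := interpl p' q'; have e2 := @interpr p' q' (An _ pA') (Bp _ qB').
  have := An _ pA'; have := Bp _ qB'; rewrite /le in lp lq.
  case: ls => ls uq' up'; first exact: lt_intercept e1 e2 ls lq.
  apply: (@lt_intercept _ (- u q') (- u p') (v q') (v p') (- slope p' q') _ (- slope p q));
   rewrite ?oppr_lt0 ?oppr_gt0// /lt in ls *; lra.
(* By [nd] the minimal line contains no point of [A] but [p] and no point of [B] but [q], so the
   counts for [le] and [lt] differ by exactly one. *)
have ltle S z : uniq S -> z \in S -> v z = slope p q * u z + icpt p q ->
    (forall x, x \in S -> v x = slope p q * u x + icpt p q -> x = z) ->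
    count (le p q) S = (count (lt p q) S).+1.
  move=> uS zS ez oz; have := count_predUI (lt p q) (pred1 z) S.
  rewrite (count_uniq_mem _ uS) zS addn1 => <-.
  rewrite -[LHS]addn0; congr addn.
    apply: eq_in_count => x xS /=; rewrite /le /lt le_eqVlt orbC; congr orb.
    by apply/eqP/eqP => [/oz|->//]; apply.
  apply/esym/eqP; rewrite -leqn0 leqNgt -has_count; apply/hasPn => x xS /=.
  by apply/negP => /andP[+ /eqP xz]; rewrite /lt xz -ez ltxx.
have cA : count (le p q) A = (count (lt p q) A).+1.
  apply: (ltle _ p) => // x xA ex.
  have := nd p q x _ _ pA qB _ ep eq ex; rewrite mem_cat xA => /(_ isT) /orP[/eqP//|/eqP xq].
  by have := An _ xA; rewrite xq ltNge ltW// Bp.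
have cB : count (le p q) B = (count (lt p q) B).+1.
  apply: (ltle _ q) => // x xB ex.
  have := nd p q x _ _ pA qB _ ep eq ex; rewrite mem_cat xB orbT => /(_ isT) /orP[/eqP xq|/eqP//].
  by have := Bp _ xB; rewrite xq ltNge ltW// An.
have eA : count (le p q) A = n.
  apply/eqP; rewrite eqn_leq gA andbT leqNgt cA ltnS; apply/negP => nlt.
  have [| | | | | |p' [q' [pS qT g']]] := bridge (seq.filter (lt p q) A) (seq.filter (le p q) B);
    rewrite ?size_filter ?filter_uniq//; try exact/mem_subseq/filter_subseq.
  move: pS qT; rewrite !mem_filter => /andP[lp' pA'] /andP[lq' qB'].
  by apply: (minimal p' q') => //; [exact: ltW | rewrite lp'].
have eB : count (le p q) B = n.
  apply/eqP; rewrite eqn_leq gB andbT leqNgt cB ltnS; apply/negP => nlt.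
  have [| | | | | |p' [q' [pS qT g']]] := bridge (seq.filter (le p q) A) (seq.filter (lt p q) B);
    rewrite ?size_filter ?filter_uniq//; try exact/mem_subseq/filter_subseq.
  move: pS qT; rewrite !mem_filter => /andP[lp' pA'] /andP[lq' qB'].
  by apply: (minimal p' q') => //; [exact: ltW | rewrite lq' orbT].
(* Raising the line slightly puts the points on it strictly below and frees it of points of [X]. *)
have [d cd hd] := right_gap [seq v x - slope p q * u x | x <- X ++ A ++ B] (icpt p q).
have ltd x : x \in X ++ A ++ B -> (v x < slope p q * u x + d) = le p q x.
  move=> xX; apply/idP/idP; rewrite /le; last by lra.
  move=> xd; rewrite leNgt; apply/negP => xc.
  by have := hd _ (map_f _ xX); lra.
exists (slope p q), d; split.
- apply/allP => x xX; apply/eqP => ex.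
  have xd : v x - slope p q * u x = d by lra.
  have : d \in [seq v x - slope p q * u x | x <- X ++ A ++ B].
    by rewrite -xd (map_f (fun x => v x - slope p q * u x))// mem_cat xX.
  by move=> /hd /(_ cd); rewrite ltxx.
- by rewrite -eA; apply: eq_in_count => x xA; rewrite ltd// !mem_cat xA orbT.
- by rewrite -eB; apply: eq_in_count => x xA; rewrite ltd// !mem_cat xA !orbT.
Qed.
End Cut.

(** * Affine functionals and perturbation to simple position *)

Section Affine.
Variable R : realType.
Implicit Types f g h : R * R * R.

Definition ev f (p : R * R) : R := f.1.1 * p.1 + f.1.2 * p.2 - f.2.

Definition det f g : R := f.1.1 * g.1.2 - f.1.2 * g.1.1.

Definition meet f g : R * R :=
  ((f.2 * g.1.2 - f.1.2 * g.2) / det f g, (f.1.1 * g.2 - f.2 * g.1.1) / det f g).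

Definition line f : set (R * R) := [set p | ev f p = 0].

Definition simple_family (L : seq (R * R * R)) : Prop :=
  [/\ all (fun f => f.1 != 0) L, uniq L,
      {in L &, forall f g, f != g -> det f g != 0}
    & forall z, (count (fun f => ev f z == 0%R) L <= 2)%N].

Lemma ev_meet f g : det f g != 0 -> ev f (meet f g) = 0 /\ ev g (meet f g) = 0.
Proof.
move=> fg; rewrite /ev /meet; split; rewrite /=; rewrite /det in fg *; field; exact: fg.
Qed.

Lemma meet_uniq f g z : det f g != 0 -> ev f z = 0 -> ev g z = 0 -> z = meet f g.
Proof.
case: z => x y fg; rewrite /ev /= => /subr0_eq fz /subr0_eq gz; congr pair; apply: (mulIf fg).
  by rewrite divfK// -fz -gz /det; ring.
by rewrite divfK// -fz -gz /det; ring.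
Qed.

(** The foot of the perpendicular from the origin and its translate by the rotated normal lie on
    [line f]; if [g] vanishes at both, subtraction gives [det f g = 0]. *)
Lemma line_inj L : simple_family L -> {in L &, injective line}.
Proof.
case=> /allP L0 _ Ld _ f g fL gL fg; apply/eqP; apply: contraT => /(Ld _ _ fL gL) /eqP[].
have f0 : f.1.1 ^+ 2 + f.1.2 ^+ 2 != 0.
  have := L0 f fL; apply: contra; rewrite paddr_eq0 ?sqr_ge0// !sqrf_eq0.
  by case: (f.1) => a b /= /andP[/eqP -> /eqP ->].
pose r := f.2 / (f.1.1 ^+ 2 + f.1.2 ^+ 2).
have z1 : ev f (f.1.1 * r, f.1.2 * r) = 0 by rewrite /ev /r /=; field.
have z2 : ev f (f.1.1 * r - f.1.2, f.1.2 * r + f.1.1) = 0 by rewrite -[RHS]z1 /ev /=; ring.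
have : line g (f.1.1 * r, f.1.2 * r) by rewrite -fg.
have : line g (f.1.1 * r - f.1.2, f.1.2 * r + f.1.1) by rewrite -fg.
by rewrite /line /ev /det /=; lra.
Qed.

(* Along the moment curve [s |-> (a + s, b + s^2, c - s^3)] the value at a point
   and the determinant with a given nonconstant functional are nonzero
   polynomials in [s], so all degeneracies are avoided by small [s > 0]. *)
Lemma perturb f (G : seq (R * R * R)) (P X : seq (R * R)) :
  all (fun g => g.1 != 0) G -> all (fun x => ev f x != 0) X ->
  exists f', [/\ f'.1 != 0, all (fun g => det f' g != 0) G,
    all (fun z => ev f' z != 0) P, all (fun x => ev f' x != 0) X
    & all (fun x => (0 < ev f' x) == (0 < ev f x)) X].
Proof.
case: f => [[a b] c] G0 X0.
(* The first coefficient, the value at [z] and the determinant with [g] along the curve. [pz z] is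
   monic of degree 3; the higher coefficients of [pd g] are the entries of [g.1] up to sign. *)
pose pa : {poly R} := 'X + a%:P; pose pb : {poly R} := 'X^2 + b%:P.
pose pz (z : R * R) : {poly R} :=
  'X^3 + z.2 *: 'X^2 + z.1 *: 'X + (ev (a, b, c) z)%:P.
pose pd g : {poly R} :=
  (- g.1.1) *: 'X^2 + g.1.2 *: 'X + (a * g.1.2 - b * g.1.1)%:P.
have pz0 z : pz z != 0.
  apply/eqP => /(congr1 (fun q : {poly R} => q`_3)).
  rewrite !coefD !coefZ !coefXn coefX coefC /= !(mulr0, addr0, coef0).
  by apply/eqP/oner_neq0.
have pd0 g : g.1 != 0 -> pd g != 0.
  move=> g0; apply: contra g0 => /eqP e.
  have := congr1 (fun q : {poly R} => q`_2) e; have := congr1 (fun q : {poly R} => q`_1) e.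
  rewrite !coefD !coefZ !coefXn coefX !coefC /= ?coef0 !(mulr0, addr0, add0r, mulr1).
  by case: (g.1) => u v /= ->; rewrite mul0r addr0 => /eqP; rewrite oppr_eq0 => /eqP ->.
have pa0 : pa != 0 by rewrite -size_poly_eq0 size_XaddC.
(* For [0 < s < 1] the value at [x] moves by at most [s * (|x.1| + |x.2| + 1)], so it keeps its sign
   while [s] is below this bound. *)
pose bnd x := `|ev (a, b, c) x| / (`|x.1| + `|x.2| + 1).
have [e e0 he] : exists2 e, 0 < e & forall x, x \in X -> e < bnd x.
  have [e e0 he] := right_gap [seq bnd x | x <- X] 0.
  exists e => // x xX; apply: he; first exact: map_f.
  by rewrite divr_gt0// ?normr_gt0 ?(allP X0)//; have := normr_ge0 x.1; have := normr_ge0 x.2; lra.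
have [||s [s0]] := @avoid_roots R (pa :: [seq pz z | z <- P] ++ [seq pd g | g <- G]) (Num.min e 1).
  by rewrite lt_min e0 /=.
  rewrite /= pa0 all_cat !all_map /=; apply/andP; split; apply/allP => z zP /=.
    exact: pz0.
  by apply: pd0; apply: (allP G0).
rewrite lt_min => /andP[se s1]; rewrite /= all_cat !all_map => /and3P[sa sP sG].
exists (a + s, b + s ^+ 2, c - s ^+ 3).
have ez z : ev (a + s, b + s ^+ 2, c - s ^+ 3) z = (pz z).[s].
  by rewrite /pz !hornerE /ev /=; ring.
have sX x : x \in X -> `|ev (a + s, b + s ^+ 2, c - s ^+ 3) x - ev (a, b, c) x| < `|ev (a, b, c) x|.
  move=> xX; have := he x xX; rewrite /bnd => ex.
  have d0 : 0 < `|x.1| + `|x.2| + 1 by have := normr_ge0 x.1; have := normr_ge0 x.2; lra.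
  apply: (@le_lt_trans _ _ (s * (`|x.1| + `|x.2| + 1))); last first.
    by rewrite -ltr_pdivlMr//; apply: lt_trans se ex.
  have -> : ev (a + s, b + s ^+ 2, c - s ^+ 3) x - ev (a, b, c) x =
    s * (x.1 + s * x.2 + s ^+ 2) by rewrite /ev /=; ring.
  rewrite normrM (gtr0_norm s0) ler_pM2l//.
  apply: le_trans (ler_normD _ _) _; apply: lerD.
    apply: le_trans (ler_normD _ _) _; rewrite lerD2l normrM (gtr0_norm s0).
    by rewrite ler_piMl// ltW.
  by rewrite ger0_norm ?sqr_ge0// expr_le1// ltW.
split.
- by apply: contra sa => /eqP[e1 _]; rewrite /pa !hornerE addrC e1.
- apply/allP => g gG; have := allP sG g gG; rewrite /= /pd !hornerE /det /=.
  by apply: contra => /eqP e1; apply/eqP; rewrite -[RHS]e1; ring.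
- by apply/allP => z zP; rewrite ez; exact: (allP sP).
- apply/allP => x xX; apply/eqP => e1; have := sX x xX; rewrite e1 sub0r normrN.
  by rewrite ltxx.
- apply/allP => x xX; have := sX x xX; have := allP X0 x xX.
  set y := ev _ x; set y' := ev _ x; rewrite neq_lt => /orP[y0|y0].
    rewrite (ltr0_norm y0) ltr_norml => /andP[_ h].
    by apply/eqP; rewrite [RHS]ltNge (ltW y0) ltNge; apply/negbF; lra.
  rewrite (gtr0_norm y0) ltr_norml => /andP[h _].
  by apply/eqP; rewrite y0; lra.
Qed.

(** Functionals are added one at a time, each made nonparallel to the earlier ones and moved off
    their meets. Keeping the signs on [X] is enough to separate the same points. *)
Lemma simple_perturbation (L : seq (R * R * R)) (X : seq (R * R)) :
  all (fun f => all (fun x => ev f x != 0) X) L ->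
  exists G, [/\ size G = size L, simple_family G,
    all (fun f => all (fun x => ev f x != 0) X) G
    & forall f, f \in L -> exists2 g, g \in G &
        {in X, forall x, (0 < ev g x) = (0 < ev f x)}].
Proof.
elim: L => [_|f L IH /= /andP[fX LX]]; first by exists [::].
have [G [sG [G0 uG Gd Gz] GX Gs]] := IH LX.
(* The pairs with [g = h] have determinant 0; division by zero makes them contribute only the
   harmless point [(0, 0)]. *)
have [f' [f0 fd fz f'X fs]] := perturb [seq meet g h | g <- G, h <- G] G0 fX.
have f'G : f' \notin G.
  by apply/negP => /(allP fd); rewrite /det mulrC subrr eqxx.
exists (f' :: G); split.
- by rewrite /= sG.
- split.
  + by rewrite /= f0.
  + by rewrite /= f'G.
  + move=> g h; rewrite !inE => /orP[/eqP ->|gG] /orP[/eqP ->|hG].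
    * by rewrite eqxx.
    * by move=> _; exact: (allP fd).
    * have := allP fd g gG; rewrite -oppr_eq0 => + _.
      by apply: contra => /eqP e; rewrite /det in e *; apply/eqP; lra.
    * exact: Gd.
  (* Two earlier functionals vanishing at a zero [z] of [f'] would make [z] one of the avoided
     meets. *)
  + move=> z /=; case: eqP => [f'z|_]; last by rewrite add0n Gz.
    rewrite addnC addn1 ltnS leqNgt -size_filter.
    case E : [seq g <- G | ev g z == 0] => [|g [|h t]]//; apply/negP => _.
    have gG : g \in [seq g <- G | ev g z == 0] by rewrite E inE eqxx.
    have hG : h \in [seq g <- G | ev g z == 0] by rewrite E !inE eqxx orbT.
    have := filter_uniq (fun g => ev g z == 0) uG; rewrite E /= inE negb_or.
    move=> /andP[/andP[gh _] _]; move: gG hG; rewrite !mem_filter.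
    move=> /andP[/eqP gz gG] /andP[/eqP hz hG].
    have zm := meet_uniq (Gd g h gG hG gh) gz hz.
    have := allP fz _ (allpairs_f meet gG hG); by rewrite -zm f'z eqxx.
- by rewrite /= f'X.
- move=> k; rewrite inE => /orP[/eqP->|/Gs[g gG gs]].
    by exists f'; [rewrite inE eqxx|move=> x /(allP fs) /eqP].
  by exists g => //; rewrite inE gG orbT.
Qed.
End Affine.

(** * Families of lines separating a point set *)

Section Arrangement.
Variable R : realType.
Implicit Types (f g : R * R * R) (L G : seq (R * R * R)) (X Y : seq (R * R)).

(** A combinatorial stand-in for a cell: only signs at the points of [Y] matter. *)
Definition unseparated L Y (P : pred (R * R)) : Prop :=
  forall f, f \in L -> {in Y &, forall p q, P p -> P q -> (0 < ev f p) = (0 < ev f q)}.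

Lemma unseparated_cons f L Y P (B : pred (R * R)) :
  unseparated (f :: L) Y P -> {in Y, forall p, B p = (0 < ev f p)} ->
  count P Y = count P [seq x <- Y | B x] \/ count P Y = count P [seq x <- Y | ~~ B x].
Proof.
move=> fP fB; rewrite !count_filter.
have [/hasP[p pY /andP[Pp Bp]]|/hasPn nB] := boolP (has (fun p => P p && B p) Y).
  left; apply: eq_in_count => q qY /=; case Pq : (P q) => //=.
  by rewrite fB// -(fP f _ p q)// ?inE ?eqxx// -fB// Bp.
right; apply: eq_in_count => q qY /=; case Pq : (P q) => //=.
by have := nB q qY; rewrite Pq.
Qed.

(* [(0, 0, -1)] is the constant functional 1: the functionals become lines only
   after the perturbation, so degenerate ones may serve as fillers. *)
Lemma ev_nseq1 n X : all (fun f => all (fun x => ev f x != 0) X) (nseq n (0, 0, -1)).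
Proof.
apply/allP => f; rewrite mem_nseq => /andP[_ /eqP ->]; apply/allP => x _.
by rewrite /ev /= !mul0r !add0r opprK oner_eq0.
Qed.

(** Induction on [k]: each cut removes [H] points from both sides, so the balance is kept and the
    bound [H * k.+1] drops by [H]. *)
Lemma two_sided_cuts X (u : R * R * R) (H k : nat) (A B : seq (R * R)) :
  {in X & &, forall p q r, p != q -> p != r -> q != r -> ~ collinear p q r} ->
  (0 < H)%N -> u.1.1 != 0 ->
  uniq A -> uniq B -> {subset A <= X} -> {subset B <= X} ->
  (forall p, p \in A -> ev u p < 0) -> (forall p, p \in B -> 0 < ev u p) ->
  (size A <= size B + 1)%N -> (size B <= size A + 1)%N ->
  (size A <= H * k.+1)%N -> (size B <= H * k.+1)%N ->
  exists L, [/\ size L = k, all (fun f => all (fun x => ev f x != 0) X) L,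
    forall P, unseparated L A P -> (count P A <= H)%N
    & forall P, unseparated L B P -> (count P B <= H)%N].
Proof.
move=> gp H0 u0; elim: k A B => [|k IH] A B uA uB AX BX An Bp AB BA sA sB.
  exists [::]; split => // P _; apply: (leq_trans (count_size _ _)); lia.
have [HA|HA] := leqP H (size A); last first.
  exists (nseq k.+1 (0, 0, -1)); split; [exact: size_nseq|exact: ev_nseq1| |];
    by move=> P _; apply: (leq_trans (count_size _ _)); lia.
have [HB|HB] := leqP H (size B); last first.
  exists (nseq k.+1 (0, 0, -1)); split; [exact: size_nseq|exact: ev_nseq1| |];
    by move=> P _; apply: (leq_trans (count_size _ _)); lia.
(* As [u.1.1 != 0], [ev u] and [snd] are affine coordinates of the plane, so a line in them is a
   genuine line and general position applies to it. *)
have [m [c [mX mA mB]]] : exists m c,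
    [/\ all (fun x : R * R => x.2 != m * ev u x + c) X,
    count (fun x => x.2 < m * ev u x + c) A = H &
    count (fun x => x.2 < m * ev u x + c) B = H].
  apply: (@simultaneous_cut R _ (ev u) snd) => // p q r m c pA qB rAB ep eq er.
  apply: contraT; rewrite negb_or => /andP[rp rq]; exfalso.
  have rX : r \in X by move: rAB; rewrite mem_cat => /orP[/AX|/BX].
  have pq : p != q.
    by apply/eqP => pq; have := An p pA; rewrite pq ltNge ltW// Bp.
  have ncol : ~ collinear p q r.
    by apply: gp => //; [exact: AX|exact: BX|rewrite eq_sym|rewrite eq_sym].
  apply: ncol.
  exists [set z : R * R | m * u.1.1 * z.1 + (m * u.1.2 - 1) * z.2 = m * u.2 - c]; split.
    exists (m * u.1.1), (m * u.1.2 - 1), (m * u.2 - c); split => //.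
    apply/eqP => -[/eqP]; rewrite mulf_eq0 (negbTE u0) orbF => /eqP -> /eqP.
    by rewrite mul0r sub0r oppr_eq0 oner_eq0.
  by rewrite /ev in ep eq er; split; [|split] => /=; lra.
pose f : R * R * R := (- m * u.1.1, 1 - m * u.1.2, c - m * u.2).
have ef x : ev f x = x.2 - (m * ev u x + c) by rewrite /ev /f /=; ring.
pose below (x : R * R) := x.2 < m * ev u x + c.
have fb Y : {subset Y <= X} -> {in Y, forall x, ~~ below x = (0 < ev f x)}.
  move=> YX x /YX /(allP mX) xX.
  by rewrite /below -leNgt le_eqVlt eq_sym (negbTE xX) /= ef subr_gt0.
have sz Y : count below Y = H -> size [seq x <- Y | ~~ below x] = (size Y - H)%N.
  by move=> YH; rewrite size_filter -(count_predC below Y) YH addKn.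
have [||||||||||L [sL LX LA LB]] := IH [seq x <- A | ~~ below x] [seq x <- B | ~~ below x];
  rewrite ?filter_uniq ?(sz _ mA) ?(sz _ mB)//; try lia.
- by move=> x; rewrite mem_filter => /andP[_ /AX].
- by move=> x; rewrite mem_filter => /andP[_ /BX].
- by move=> x; rewrite mem_filter => /andP[_ /An].
- by move=> x; rewrite mem_filter => /andP[_ /Bp].
(* A class in [Y] lies either above the new line, where the remaining cuts bound it, or among the
   [H] points below. *)
have step Y P : {subset Y <= X} -> count below Y = H -> unseparated (f :: L) Y P ->
    (forall P, unseparated L [seq x <- Y | ~~ below x] P ->
      (count P [seq x <- Y | ~~ below x] <= H)%N) -> (count P Y <= H)%N.
  move=> YX Yb fP LP; have [->|->] := unseparated_cons fP (fb Y YX).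
    apply: LP => g gL p q; rewrite !mem_filter => /andP[_ pY] /andP[_ qY].
    by apply: fP => //; rewrite inE gL orbT.
  rewrite -Yb; apply: (leq_trans (count_size _ _)).
  by rewrite size_filter; apply/eq_leq/eq_count => x; rewrite negbK.
exists (f :: L); split.
- by rewrite /= sL.
- rewrite /= LX andbT; apply/allP => x /(allP mX) xX.
  by rewrite ef subr_eq0.
- by move=> P fP; apply: step LA.
- by move=> P fP; apply: step LB.
Qed.

(** Distinct points agree only at roots of a nonzero polynomial in [t]. General position allows
    equal abscissas, so [t = 0] may fail. *)
Lemma generic_direction X : exists t : R,
  {in X &, injective (fun p : R * R => p.1 + t * p.2)}.
Proof.
pose ps (w : (R * R) * (R * R)) : {poly R} :=
  (w.1.2 - w.2.2) *: 'X + (w.1.1 - w.2.1)%:P.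
have ps0 w : w.1 != w.2 -> ps w != 0.
  case: w => [[a b] [c d]] /=; apply: contra => /eqP e.
  have := congr1 (fun q : {poly R} => q`_0) e; have := congr1 (fun q : {poly R} => q`_1) e.
  rewrite !coefD !coefZ !coefX !coefC /= !(mulr0, addr0, add0r, mulr1, coef0).
  by move=> /subr0_eq -> /subr0_eq ->.
have [||t [_ _ /allP ht]] := @avoid_roots R
    [seq ps w | w <- [seq (p, q) | p <- X, q <- X] & w.1 != w.2] 1; first exact: ltr01.
  by rewrite all_map; apply/allP => w; rewrite mem_filter => /andP[/ps0].
exists t => p q pX qX e; apply/eqP; apply: contraT => pq.
have : ps (p, q) \in [seq ps w | w <- [seq (p, q) | p <- X, q <- X] & w.1 != w.2].
  by rewrite map_f// mem_filter pq allpairs_f.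
by move=> /ht; rewrite /ps !hornerE /= => /eqP[]; lra.
Qed.

(** The halving line takes one of the [K] places; even the larger half has at most [H * K] points,
    as the [K - 1] remaining cuts require. *)
Lemma separating_family X (H K : nat) :
  uniq X ->
  {in X & &, forall p q r, p != q -> p != r -> q != r -> ~ collinear p q r} ->
  (0 < H)%N -> (0 < K)%N ->
  (size X <= 2 * H * K)%N ->
  exists L, [/\ size L = K, all (fun f => all (fun x => ev f x != 0) X) L
    & forall P, unseparated L X P -> (count P X <= H)%N].
Proof.
case: K => // k uX gp H0 _ sX; have [t tinj] := generic_direction X.
have [|d dX cd] := @count_lt_exists R _ _ X (size X)./2 uX tinj; first by rewrite -divn2 leq_div.
pose u : R * R * R := (1, t, d).
have eu x : ev u x = x.1 + t * x.2 - d by rewrite /ev /= mul1r.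
have u0 : all (fun x => ev u x != 0) X.
  by apply/allP => x /(allP dX); rewrite eu subr_eq0.
pose pos x := 0 < ev u x.
have sB : size [seq x <- X | ~~ pos x] = (size X)./2.
  rewrite size_filter -cd; apply: eq_in_count => x /(allP u0) xu /=.
  by rewrite /pos -leNgt le_eqVlt (negbTE xu) /= eu subr_lt0.
have sA : size [seq x <- X | pos x] = (size X - (size X)./2)%N.
  by rewrite -sB -(count_predC pos X) !size_filter addnK.
have [|||||||||||L [sL LX LA LB]] := @two_sided_cuts X u H k
  [seq x <- X | ~~ pos x] [seq x <- X | pos x] gp H0;
  rewrite ?filter_uniq ?sA ?sB ?oner_neq0//; try lia.
- by move=> x; rewrite mem_filter => /andP[].
- by move=> x; rewrite mem_filter => /andP[].
- move=> x; rewrite mem_filter => /andP[+ /(allP u0) xu].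
  by rewrite /pos -leNgt le_eqVlt (negbTE xu).
- by move=> x; rewrite mem_filter => /andP[].
exists (u :: L); split; rewrite /= ?sL ?u0// => P uP.
have sub Y : {subset Y <= X} -> unseparated L Y P.
  by move=> YX f fL p q /YX pX /YX qX; apply: uP => //; rewrite inE fL orbT.
have [->|->] := unseparated_cons (B := pos) uP (fun _ _ => erefl).
  by apply: LB; apply: sub => x; rewrite mem_filter => /andP[].
by apply: LA; apply: sub => x; rewrite mem_filter => /andP[].
Qed.
End Arrangement.

(** * From sign classes to cells of an arrangement *)

Lemma continuous_ev (R : realType) (f : R * R * R) : continuous (ev f : R * R -> R).
Proof.
move=> z; apply: cvgB; last exact: cvg_cst.
apply: cvgD; (apply: cvgM; first exact: cvg_cst); [exact: cvg_fst|exact: cvg_snd].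
Qed.

(** The image of [C] is an interval, so a change of sign would put 0 in it. *)
Lemma connected_same_sign (R : realType) (T : topologicalType) (f : T -> R) (C : set T) :
  connected C -> {within C, continuous f} -> (forall x, C x -> f x != 0) ->
  forall p q, C p -> C q -> (0 < f p) = (0 < f q).
Proof.
move=> Cc fc f0.
suff pos p q : C p -> C q -> 0 < f p -> 0 < f q.
  by move=> p q Cp Cq; apply/idP/idP; exact: pos.
move=> Cp Cq fp; rewrite ltNge le_eqVlt negb_or f0//=; apply/negP => fq.
have /connected_intervalP itv := connected_continuous_connected Cc fc.
have [|x Cx fx] := itv (f q) (f p) (imageP f Cq) (imageP f Cp) 0.
  by rewrite (ltW fq) (ltW fp).
by have := f0 x Cx; rewrite fx eqxx.
Qed.

Lemma simple_arrangement_lines (R : realType) (G : seq (R * R * R)) :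
  simple_family G ->
  simple_arrangement (size G) [fset line g | g in G]%fset.
Proof.
move=> sG; have [/allP G0 uG Gd Gz] := sG.
have lineP l : l \in [fset line g | g in G]%fset -> exists2 g, g \in G & l = line g.
  by move=> /imfsetP[g /= gG ->]; exists g.
split.
- rewrite card_in_imfset /=; first by rewrite undup_id.
  by apply: line_inj.
- move=> l /lineP[g gG ->]; exists g.1.1, g.1.2, g.2; split.
    by rewrite -surjective_pairing G0.
  by apply/seteqP; split => z; rewrite /line /ev /=; [move/subr0_eq|move=> ->; rewrite subrr].
- move=> l m /lineP[g gG ->] /lineP[h hG ->] gh; rewrite /parallel => e.
  have /ev_meet[mg mh] : det g h != 0 by apply: Gd => //; apply: contra_neq gh => ->.
  have : (line g `&` line h) (meet g h) by split.
  by rewrite e.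
- move=> l m n /lineP[f fG ->] /lineP[g gG ->] /lineP[h hG ->] fg fh gh.
  apply/seteqP; split => // z [[/= fz gz] hz].
  have : (size [:: f; g; h] <= size [seq k <- G | ev k z == 0%R])%N.
    apply: uniq_leq_size.
      rewrite /= !inE negb_or !andbT; apply/andP; split; [apply/andP; split|].
      + by apply: contra_neq fg => ->.
      + by apply: contra_neq fh => ->.
      + by apply: contra_neq gh => ->.
    move=> k; rewrite !inE mem_filter.
    by move=> /or3P[] /eqP ->; apply/andP; split => //; apply/eqP.
  by rewrite size_filter => /leq_trans /(_ (Gz z)).
Qed.

(** A cell is connected and misses all lines, so every functional keeps its sign there: its points
    in [X] form an unseparated class. *)
Lemma max_cell_count_lines (R : realType) (X : {fset R * R}) (G : seq (R * R * R)) (H : nat) :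
  (forall P, unseparated G X P -> (count P X <= H)%N) ->
  (max_cell_count X [fset line g | g in G]%fset <= H)%N.
Proof.
move=> GH; apply/bigmax_leqP => n /asboolP[c [x xU <-] <-]; rewrite /cell_count.
set C := connected_component _ x.
have sepC : unseparated G X (mem C).
  move=> g gG p q _ _; rewrite !inE => Cp Cq.
  have Cc : connected C by exact: component_connected.
  apply: connected_same_sign Cc _ _ _ _ Cp Cq.
    by apply: continuous_subspaceT; exact: continuous_ev.
  move=> y /connected_component_sub Uy; apply/eqP => gy; apply: Uy.
  by exists (line g) => //=; apply/imfsetP; exists g.
apply: leq_trans (GH _ sepC); rewrite -size_filter.
apply: uniq_leq_size (fset_uniq _) _ => y.
rewrite in_fset_set; last by apply: finite_setIl; exact: finite_fset.
by rewrite inE /= => -[yX Cy]; rewrite mem_filter yX andbT inE.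
Qed.

Theorem theorem2p2 (R : realType) (N H K : nat) (X : {fset R * R})
    (cardX : #|` X| = N) (gpX : general_position X)
    (H_ge1 : (1 <= H)%N) (K_ge1 : (1 <= K)%N)
    (K_ge : Num.ceil (N%:R / (2 * H%:R) : R) <= K%:Z) :
  (CUT K X <= H)%N.
Proof.
have NHK : (size X <= 2 * H * K)%N.
  rewrite cardX -(ler_nat R) natrM mulrC -ler_pdivrMr; last by rewrite ltr0n; lia.
  by rewrite natrM; apply: le_trans (Num.Theory.ceil_ge _) _; rewrite [leRHS]pmulrn ler_int.
have gpS : {in X & &, forall p q r, p != q -> p != r -> q != r -> ~ collinear p q r}.
  by move=> p q r pX qX rX; exact: gpX.
have [L [sL LX LH]] := separating_family (fset_uniq X) gpS H_ge1 K_ge1 NHK.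
have [G [sG Gs GX GL]] := simple_perturbation LX.
(* [CUT] is a minimum, so exhibiting one arrangement suffices. *)
rewrite /CUT; case: ex_minnP => m _ mmin.
apply: (@leq_trans (max_cell_count X [fset line g | g in G]%fset)).
  apply: mmin; apply/asboolP; exists [fset line g | g in G]%fset; split => //.
    by rewrite -sL -sG; apply: simple_arrangement_lines.
  move=> x xX [l /= /imfsetP[g /= gG ->]].
  by rewrite /line /=; apply/eqP; apply: (allP (allP GX g gG)).
(* Each functional of [L] has the signs of one of [G] on [X], so a class unseparated by [G] is
   unseparated by [L]. *)
apply: max_cell_count_lines => P GP; apply: LH => f fL p q pX qX Pp Pq.
by have [g gG gf] := GL f fL; rewrite -!gf//; exact: GP.
Qed.
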